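(* Let $P$ be a distribution on $\mathcal X\times\mathcal Y$, where every $\mathbf x\in\mathcal X\subseteq\mathbb R^d$ satisfies $\|\mathbf x\|\le 1$ and $\mathcal Y=\{-1,+1\}$ (classification) or $\mathcal Y=[-1,1]$ (regression), and let $(\mathbf x_1,y_1),\dots,(\mathbf x_n,y_n)$ be i.i.d. samples from $P$. Let $R>0$ and $\mathscr W=\{\mathbf w\in\mathbb R^d:\|\mathbf w\|\le R\}$. Let $\ell:\mathbb R\to\mathbb R_+$ be a convex loss such that $z\mapsto\exp(-\alpha\ell(z))$ is concave for $|z|\le R$ (for some $\alpha>0$) and $|\ell'(z)|\le G$. Let $\mathcal L(\mathbf w)=\mathrm E_{(\mathbf x,y)\sim P}[\ell(y\mathbf w^\top\mathbf x)]$ and $\mathbf w_*\in\arg\min_{\mathbf w\in\mathscr W}\mathcal L(\mathbf w)$. Suppose Assumption (I) holds with constant $\theta>0$, i.e. $\mathrm E[(\ell'(y\mathbf w_*^\top\mathbf x))^2\mathbf x\mathbf x^\top]\succeq\theta\,\mathrm E[\mathbf x\mathbf x^\top]$. Let $\widehat{\mathbf w}_*$ be a solution of $\min_{\mathbf w\in\mathscr W}\frac1n\sum_{i=1}^n\ell(y_i\mathbf w^\top\mathbf x_i)$. Define \[ \gamma=\max\left(1,\frac{G^2}{\theta},\frac{G}{\alpha\theta R}\right),\qquad \rho_0=\max\left(32\gamma,\sqrt{\gamma\left(28+\frac{3}{GR}\right)}\right). \] Then for any $t>0$, with probability at least $1-2me^{-t}$, where $m=\lceil\log_2 n\rceil$,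 \[ \mathcal L(\widehat{\mathbf w}_* )-\mathcal L(\mathbf w_* )\le\left(GR\left[32\rho_0+28\right]+3\right)\frac{t+2+d\log n}{n}. \]
   Context: $\ell'$ denotes the derivative of $\ell$; $\succeq$ denotes the positive semidefinite (Loewner) order; expectations are over $(\mathbf x,y)\sim P$. *)

(* Defs.v *)
From HB Require Import structures.
From mathcomp Require Import all_boot all_order all_algebra.
From mathcomp Require Import all_classical all_reals all_analysis.
Set Implicit Arguments. Unset Strict Implicit. Unset Printing Implicit Defensive.
Import Order.TTheory GRing.Theory Num.Theory.
Local Open Scope classical_set_scope.
Local Open Scope ring_scope.

Definition dotv (R : realType) (d : nat) (u v : 'rV[R]_d) : R :=
  \sum_(j < d) u 0 j * v 0 j.
Definition normv (R : realType) (d : nat) (u : 'rV[R]_d) : R :=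
  Num.sqrt (\sum_(j < d) u 0 j ^+ 2).

Definition convex_on (R : realType) (D : set R) (f : R -> R) : Prop :=
  forall x y (l : R), D x -> D y -> 0 <= l <= 1 ->
    f (l * x + (1 - l) * y) <= l * f x + (1 - l) * f y.
Definition concave_on (R : realType) (D : set R) (f : R -> R) : Prop :=
  forall x y (l : R), D x -> D y -> 0 <= l <= 1 ->
    l * f x + (1 - l) * f y <= f (l * x + (1 - l) * y).

Definition loewner_ge (R : realType) (d : nat) (A B : 'M[R]_d) : Prop :=
  forall v : 'cV[R]_d, 0 <= (v^T *m (A - B) *m v) 0 0.

Definition pop_risk (R : realType) (d : nat) (dT : measure_display)
  (T : measurableType dT) (P : probability T R)
  (feat : T -> 'rV[R]_d) (lab : T -> R) (ell : R -> R) (w : 'rV[R]_d) : R :=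
  Rintegral P setT (fun z => ell (lab z * dotv w (feat z))).

Definition grad_moment (R : realType) (d : nat) (dT : measure_display)
  (T : measurableType dT) (P : probability T R)
  (feat : T -> 'rV[R]_d) (lab : T -> R) (ell : R -> R) (w : 'rV[R]_d)
  : 'M[R]_d :=
  \matrix_(j < d, k < d) Rintegral P setT
     (fun z => (derive1 ell (lab z * dotv w (feat z))) ^+ 2 * feat z 0 j * feat z 0 k).

Definition second_moment (R : realType) (d : nat) (dT : measure_display)
  (T : measurableType dT) (P : probability T R) (feat : T -> 'rV[R]_d)
  : 'M[R]_d :=
  \matrix_(j < d, k < d) Rintegral P setT (fun z => feat z 0 j * feat z 0 k).

Definition emp_risk (R : realType) (d n : nat) (xs : 'I_n -> 'rV[R]_d)
  (ys : 'I_n -> R) (ell : R -> R) (w : 'rV[R]_d) : R :=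
  n%:R^-1 * \sum_(i < n) ell (ys i * dotv w (xs i)).

Definition iid_sample (R : realType) (dT : measure_display) (T : measurableType dT)
  (P : probability T R) (dO : measure_display) (Omega : measurableType dO)
  (Pr : probability Omega R) (n : nat) (Z : 'I_n -> Omega -> T) : Prop :=
  [/\ (forall i, measurable_fun setT (Z i)),
      (forall i (A : set T), measurable A -> Pr (Z i @^-1` A) = P A) &
      (forall A : 'I_n -> set T, (forall i, measurable (A i)) ->
         Pr (\bigcap_(i in [set: 'I_n]) (Z i @^-1` A i)) =
         (\prod_(i < n) Pr (Z i @^-1` A i))%E)].

(* Main.v *)
(** Write h_w for the excess loss of w over wstar.  Concavity of
    exp (- alpha ell) along segments, together with the optimality of wstar,
    gives E exp (- alpha h_w) <= 1; hence, for small e <= alpha,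
    E exp (- e h_w / 2) <= 1 - e E h_w / 10, which is a Bernstein condition in
    exponential form.  Chernoff's method then bounds E h_w by 5 times the
    empirical mean of h_w plus O(s / (e n)) with probability 1 - exp (- s).  A
    union bound over a grid of mesh Rad / n^2 in the ball, followed by the
    Lipschitz property of the loss, transfers the bound to the empirical
    minimiser, for e = 1 / (2 G Rad gamma).  Assumption (I) enters only through
    theta <= G^2 (or else all features vanish almost surely), which gives
    e <= alpha. *)
Require Import Defs.
From HB Require Import structures.
From mathcomp Require Import all_boot all_order all_algebra.
From mathcomp Require Import all_classical all_reals all_analysis.
From mathcomp Require Import measurable_realfun ring lra.
Import Order.TTheory GRing.Theory Num.Theory.
Local Open Scope classical_set_scope.
Local Open Scope ring_scope.

(** * Elementary inequalities for the exponential *)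

Section ExpBounds.
Context {R : realType}.
Implicit Types u x s : R.

(** The tangent bound 1 + x <= exp x gives exp (- x) (1 + x) <= 1, while (1 - x + 2 x^2) (1 + x) = 1
    + x^2 (1 + 2 x) >= 1 in this range. *)
Lemma expRN_quad_ub x : `|x| <= 2^-1 -> expR (- x) <= 1 - x + 2 * x ^+ 2.
Proof.
rewrite ler_norml => /andP[xl xu].
have h1 : 1 + x <= expR x := expR_ge1Dx x.
have e : expR (- x) * expR x = 1 by rewrite mulrC expRxMexpNx_1.
have p : 0 < expR (- x) := expR_gt0 _.
have h2 : expR (- x) * (1 + x) <= 1 by nra.
have h3 : 0 <= x ^+ 2 * (1 + 2 * x) by rewrite mulr_ge0 ?sqr_ge0//; lra.
nra.
Qed.

(** Convexity of exp on the segment from 0 to x: the tangent at s x lies below exp at both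
    endpoints, and averaging with weights 1 - s and s cancels the slope. *)
Lemma expR_scale_ub s x : 0 <= s <= 1 -> expR (s * x) <= 1 + s * (expR x - 1).
Proof.
move=> /andP[s0 s1].
have h1 : expR x = expR (s * x) * expR ((1 - s) * x) by rewrite -expRD; congr expR; ring.
have h2 : 1 + (1 - s) * x <= expR ((1 - s) * x) := expR_ge1Dx _.
have h3 : 1 = expR (s * x) * expR (- (s * x)) by rewrite expRxMexpNx_1.
have h4 : 1 + - (s * x) <= expR (- (s * x)) := expR_ge1Dx _.
have p : 0 < expR (s * x) := expR_gt0 _.
have h5 : expR (s * x) * (1 + (1 - s) * x) <= expR x by rewrite h1 ler_pM2l.
have h6 : expR (s * x) * (1 - s * x) <= 1 by rewrite [leRHS]h3 ler_pM2l.
have h7 : s * (expR (s * x) * (1 + (1 - s) * x)) <= s * expR x by rewrite ler_wpM2l.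
have h8 : (1 - s) * (expR (s * x) * (1 - s * x)) <= (1 - s) * 1.
  by rewrite ler_wpM2l// subr_ge0.
lra.
Qed.

(* With [v = expR (- u / 2)], [v = (1 + v^2 - (v - 1)^2) / 2], and
   [(v - 1)^2] dominates a multiple of [v - 1 - ln v] when [v >= 1/2]. *)
Lemma expRN_half_ub u : u <= 1 -> 10 * expR (- (u / 2)) <= 6 + 4 * expR (- u) - u.
Proof.
move=> u1; set v := expR (- (u / 2)); set w := expR (u / 2).
have vw : w * v = 1 by rewrite /w /v expRxMexpNx_1.
have -> : expR (- u) = v * v by rewrite -expRD; congr expR; field.
have v12 : 1 - u / 2 <= v by exact: expR_ge1Dx.
have w1 : 1 + u / 2 <= w by exact: expR_ge1Dx.
have v0 : 0 < v by exact: expR_gt0.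
have w0 : 0 < w by exact: expR_gt0.
have w2 : w <= 2 by nra.
(* As [w] is the inverse of [v], the left side equals v - 2 + w, and [w1] then supplies the term
   linear in [u]. *)
have h : (v - 1) ^+ 2 * w <= (v - 1) ^+ 2 * 2 by rewrite ler_wpM2l ?sqr_ge0.
have e : (v - 1) ^+ 2 * w = v - 2 + w.
  have -> : (v - 1) ^+ 2 * w = v * (w * v) - 2 * (w * v) + w by ring.
  by rewrite vw; ring.
rewrite e in h; nra.
Qed.

End ExpBounds.

(** * Expectations of bounded functions and exponential moments *)

Section BoundedExpectation.
Context {R : realType} {dT : measure_display} {T : measurableType dT}.
Variable P : probability T R.
Implicit Types f g h : T -> R.

Lemma bounded_integrable {f} {B : R} : measurable_fun setT f ->
  (forall z, `|f z| <= B) -> P.-integrable setT (EFin \o f).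
Proof.
move=> mf fB; apply: measurable_bounded_integrable => //.
  by rewrite -ge0_fin_numE ?fin_num_measure.
exists B; split; first exact: num_real.
by move=> M BM z _ /=; exact: le_trans (fB z) (ltW BM).
Qed.

Lemma Rintegral_prob_cst (c : R) : \int[P]_z c = c.
Proof. by rewrite Rintegral_cst//= probability_setT mulr1. Qed.

Lemma integrable_aff (c k : R) {f} : P.-integrable setT (EFin \o f) ->
  P.-integrable setT (EFin \o (fun z => c + k * f z)).
Proof.
move=> fi; rewrite (_ : _ \o _ = (cst c%:E \+ (fun z => k%:E * (f z)%:E))%E)//.
apply: integrableD => //; last exact: integrableZl.
exact: (@bounded_integrable (cst c) `|c|).
Qed.

Lemma Rintegral_aff (c k : R) {f} : P.-integrable setT (EFin \o f) ->
  \int[P]_z (c + k * f z) = c + k * \int[P]_z f z.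
Proof.
move=> fi; have ci : P.-integrable setT (EFin \o cst c).
  exact: (@bounded_integrable (cst c) `|c|).
rewrite (RintegralD _ ci)//= ?Rintegral_prob_cst ?RintegralZl//.
rewrite (_ : _ \o _ = (fun z => k%:E * (f z)%:E)%E)//; exact: integrableZl.
Qed.

Lemma measurable_expRM (c : R) {f} : measurable_fun setT f ->
  measurable_fun setT (fun z => expR (c * f z)).
Proof.
move=> mf; apply: measurableT_comp; first exact: measurable_expR.
exact: measurable_funM.
Qed.

Lemma integrable_expRM (c : R) {B : R} {f} : measurable_fun setT f ->
  (forall z, `|f z| <= B) -> P.-integrable setT (EFin \o (fun z => expR (c * f z))).
Proof.
move=> mf fB; apply: (@bounded_integrable _ (expR (`|c| * B))).
  exact: measurable_expRM.
move=> z; rewrite ger0_norm ?expR_ge0// ler_expR (le_trans (ler_norm _))//.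
by rewrite normrM ler_wpM2l.
Qed.

(* [hl l] is the excess loss at the point at distance [l] along the segment
   from the minimiser; letting [l -> 0] replaces the first-order optimality
   condition. *)
Lemma exp_moment_le1 (a B : R) h (hl : R -> T -> R) :
  0 < a -> 0 < B -> measurable_fun setT h -> (forall z, `|h z| <= B) ->
  (forall l, 0 <= l <= 1 -> [/\ measurable_fun setT (hl l),
     forall z, `|hl l z| <= l * B, 0 <= \int[P]_z hl l z &
     forall z, 1 + l * (expR (- a * h z) - 1) <= expR (- a * hl l z)]) ->
  \int[P]_z expR (- a * h z) <= 1.
Proof.
move=> a0 B0 mh hB H; rewrite leNgt; apply/negP => q0.
set I := \int[P]_z expR (- a * h z) in q0.
pose q := I - 1; pose K := a * B; have K0 : 0 < K by rewrite mulr_gt0.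
have {}q0 : 0 < q by rewrite subr_gt0.
(* Each summand of [D] serves one purpose for l = q / D: [q] gives l <= 1, 2 K q gives l K <= 1/2 as
   [expRN_quad_ub] requires, and 4 K^2 contradicts the final q <= 2 K^2 l. *)
pose D := 4 * K ^+ 2 + 2 * K * q + q.
have D0 : 0 < D by rewrite /D; nra.
pose l := q / D.
have l0 : 0 < l by rewrite divr_gt0.
have lD : l * D = q by rewrite /l mulfVK// gt_eqF.
have l1 : l <= 1 by rewrite ler_pdivrMr// mul1r /D; nra.
have lK : l * K <= 2^-1.
  rewrite /l mulrAC ler_pdivrMr// /D; nra.
have [|mhl hlB hl0 hle] := H l; first by rewrite (ltW l0).
have ih := integrable_expRM (- a) mh hB.
have ihl := integrable_expRM (- a) mhl hlB.
have il := bounded_integrable mhl hlB.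
(* The exponential moment along the segment grows at least linearly in [l] by [s1], but at most
   quadratically by [s2], where the linear term has a favourable sign because [hl l] has nonnegative
   mean. *)
have s1 : 1 + l * q <= \int[P]_z expR (- a * hl l z).
  have -> : 1 + l * q = \int[P]_z ((1 - l) + l * expR (- a * h z)).
    by rewrite Rintegral_aff// -/I /q; ring.
  apply: le_Rintegral => //; first exact: integrable_aff.
  by move=> z _; apply: le_trans (hle z); rewrite le_eqVlt; apply/orP; left;
    apply/eqP; ring.
have s2 : \int[P]_z expR (- a * hl l z) <= 1 + 2 * (l * K) ^+ 2.
  apply: (@le_trans _ _ (\int[P]_z ((1 + 2 * (l * K) ^+ 2) + (- a) * hl l z))).
    apply: le_Rintegral => //; first exact: integrable_aff.
    move=> z _.
    have b : `|a * hl l z| <= l * K.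
      rewrite normrM (gtr0_norm a0) /K mulrCA ler_pM2l//; exact: hlB.
    rewrite mulNr; apply: le_trans (expRN_quad_ub _ (le_trans b lK)) _.
    have : (a * hl l z) ^+ 2 <= (l * K) ^+ 2.
      by move: b; rewrite ler_norml => /andP[]; nra.
    by move=> ?; lra.
  rewrite Rintegral_aff//; nra.
have : l * q <= 2 * (l * K) ^+ 2 by lra.
have -> : 2 * (l * K) ^+ 2 = l * (2 * K ^+ 2 * l) by ring.
rewrite ler_pM2l// leNgt => /negP; apply.
have : 0 < l * (2 * K * q + q) by do ?[apply: mulr_gt0 => // | apply: addr_gt0 => //].
have : 0 < l * K ^+ 2 by rewrite mulr_gt0// exprn_gt0.
by rewrite /D in lD; lra.
Qed.

(** Convexity in the exponent first lowers [a] to [e], keeping the moment at most 1. Integrating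
    [expRN_half_ub] at u = e h then gives the strict gain: 6 + 4 * 1 = 10 leaves exactly - e E h on
    the right. *)
Lemma exp_moment_contract (a e B : R) h :
  0 < e <= a -> e * B <= 1 -> measurable_fun setT h -> (forall z, `|h z| <= B) ->
  \int[P]_z expR (- a * h z) <= 1 ->
  \int[P]_z expR (- (e / 2) * h z) <= 1 - e / 10 * \int[P]_z h z.
Proof.
move=> /andP[e0 ea] eB mh hB Ia.
have a0 : 0 < a := lt_le_trans e0 ea.
have ih := bounded_integrable mh hB.
have ie c := integrable_expRM c mh hB.
pose s := e / a.
have s01 : 0 <= s <= 1.
  by rewrite /s divr_ge0 ?(ltW e0) ?(ltW a0)//= ler_pdivrMr// mul1r.
have sa : s * a = e by rewrite /s mulfVK// gt_eqF.
have Ie : \int[P]_z expR (- e * h z) <= 1.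
  apply: (@le_trans _ _ (\int[P]_z ((1 - s) + s * expR (- a * h z)))).
    apply: le_Rintegral => //; first exact: integrable_aff.
    move=> z _; have := @expR_scale_ub R s (- a * h z) s01.
    have -> : s * (- a * h z) = - e * h z by rewrite -sa; ring.
    lra.
  rewrite Rintegral_aff//; nra.
have i1 := integrable_aff 6 4 (ie (- e)).
have i2 := integrable_aff 0 (- e) ih.
have i3 := integrable_aff 0 10 (ie (- (e / 2))).
have : \int[P]_z (0 + 10 * expR (- (e / 2) * h z)) <=
    \int[P]_z ((6 + 4 * expR (- e * h z)) + (0 + - e * h z)).
  apply: le_Rintegral => //; first exact: (integrableD _ i1 i2).
  move=> z _; have := @expRN_half_ub R (e * h z).
  have -> : - (e * h z / 2) = - (e / 2) * h z by field.
  rewrite !add0r -!mulNr; apply; apply: le_trans eB.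
  by rewrite ler_pM2l// (le_trans (ler_norm _)).
by rewrite (RintegralD _ i1 i2)// !Rintegral_aff//; lra.
Qed.

End BoundedExpectation.

(** The integral of a nonnegative function is a supremum over the simple functions below it, and
    this set grows with the function. The lemma serves for integrands containing [derive1 ell]. *)
Lemma ge0_le_integralT {R : realType} {dT : measure_display} {T : measurableType dT}
    (mu : {measure set T -> \bar R}) (f g : T -> \bar R) :
  (forall z, 0 <= f z)%E -> (forall z, f z <= g z)%E ->
  (\int[mu]_z f z <= \int[mu]_z g z)%E.
Proof.
move=> f0 fg; rewrite !ge0_integralTE// => [|z]; last exact: le_trans (f0 z) (fg z).
apply: le_ereal_sup => _ [h hf <-]; exists h => // z.
exact: le_trans (hf z) (fg z).
Qed.

(** * Product moments of an i.i.d. sample *)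

Section IidProduct.
Context {R : realType} {dT : measure_display} {T : measurableType dT}.
Context {dO : measure_display} {Omega : measurableType dO}.
Context {P : probability T R} {Pr : probability Omega R} {n : nat}.
Context {Z : 'I_n -> Omega -> T}.
Hypothesis iidZ : iid_sample P Pr Z.

(** Distributing the product over the sums yields one term per map from 'I_n to 'I_K. Each term is a
    multiple of the indicator of a rectangle, where independence applies; the distributive law is
    then read backwards. *)
Lemma iid_prod_simple (K : nat) (c : 'I_K -> R) (A : 'I_K -> set T) :
  (forall k, 0 <= c k) -> (forall k, measurable (A k)) ->
  (\int[Pr]_om (\prod_(i < n) \sum_(k < K) c k * \1_(A k) (Z i om))%:E)%E =
  ((\sum_(k < K) c k * fine (P (A k))) ^+ n)%:E.
Proof.
case: iidZ => mZ PZ indZ c0 mA.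
have mB (f : {ffun 'I_n -> 'I_K}) :
    measurable (\bigcap_(i in [set: 'I_n]) (Z i @^-1` A (f i))).
  apply: fin_bigcap_measurable; first exact: finite_finset.
  by move=> i _; rewrite -[X in measurable X]setTI; apply: mZ.
transitivity (\int[Pr]_om (\sum_(f : {ffun 'I_n -> 'I_K})
   (\prod_(i < n) c (f i))%:E *
   (\1_(\bigcap_(i in [set: 'I_n]) (Z i @^-1` A (f i))) om)%:E))%E.
  apply: eq_integral => om _; rewrite bigA_distr_bigA/= -sumEFin.
  apply: eq_bigr => f _; rewrite -EFinM; congr EFin.
  rewrite big_split/=; congr (_ * _); rewrite indicE.
  case: (boolP (om \in _)) => [|].
    by rewrite inE => H; apply: big1 => i _; rewrite indicE mem_set//; apply: H.
  rewrite notin_setE => H; have [i Hi] : exists i, ~ A (f i) (Z i om).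
    by apply/existsNP => H'; apply: H => i _; exact: H'.
  by rewrite (bigD1 i)//= indicE memNset// mul0r.
rewrite ge0_integral_sum//.
- transitivity (\prod_(i < n) \sum_(k < K) c k * fine (P (A k)))%:E; last first.
    by rewrite prodr_const card_ord.
  rewrite bigA_distr_bigA/= -sumEFin.
  apply: eq_bigr => f _; rewrite ge0_integralZl_EFin//; last exact: prodr_ge0.
    rewrite integral_indic// setIT/= indZ//.
    rewrite big_split/= EFinM; congr (_ * _)%E.
    rewrite -prodEFin; apply: eq_bigr => i _; rewrite PZ// fineK//.
    exact: fin_num_measure.
  by apply/measurable_EFinP; exact: measurable_indic.
- move=> f; apply/measurable_EFinP; exact: measurable_funM.
- by move=> f om _; rewrite mule_ge0// lee_fin ?prodr_ge0// indicE; case: (_ \in _).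
Qed.

(* [g] is rounded up to a multiple of [e], so that only the product rule for
   rectangles is needed. *)
Lemma iid_markov {g : T -> R} {M e : R} (c : R) :
  measurable_fun setT g -> (forall z, 0 <= g z <= M) -> 0 < e ->
  let S := [set om | c <= \prod_(i < n) g (Z i om)] in
  measurable S /\
  (c%:E * Pr S <= ((\int[P]_z g z + e) ^+ n)%:E)%E.
Proof.
case: (iidZ) => mZ PZ indZ mg gM e0 S.
have mprod : measurable_fun setT (fun om => \prod_(i < n) g (Z i om)).
  apply: measurable_prod => i _; exact: measurableT_comp (mZ i).
have mS : measurable S.
  rewrite -[S]setTI; have := mprod measurableT _ (@measurable_itv R `[c, +oo[).
  by congr measurable; apply/seteqP; split => om /=; rewrite in_itv/= andbT.
split=> //.
(* The levels have width [e]; the successor includes the half-open level that contains [M]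
   itself. *)
pose K := (Num.truncn (M / e)).+1.
pose A (k : 'I_K) := g @^-1` `[k%:R * e, k.+1%:R * e[%classic.
have mA k : measurable (A k).
  by rewrite -[A k]setTI; apply: mg => //; exact: measurable_itv.
pose s z := \sum_(k < K) (k.+1%:R * e) * \1_(A k) z : R.
have sE z : g z <= s z <= g z + e.
  have /andP[g0 gMz] := gM z.
  have ge0 : 0 <= g z / e by rewrite divr_ge0// ltW.
  have /andP[t1 t2] := truncn_itv ge0.
  have tK : (Num.truncn (g z / e) < K)%N.
    by rewrite ltnS le_truncn// ler_pM2r// invr_gt0.
  rewrite ler_pdivlMr// in t1; rewrite ltr_pdivrMr// in t2.
  have -> : s z = (Num.truncn (g z / e)).+1%:R * e.
    rewrite /s (bigD1 (Ordinal tK))//= big1 ?addr0.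
      by rewrite indicE mem_set ?mulr1//= /A/= in_itv/= t1.
    move=> k kN; rewrite indicE memNset ?mulr0//= /A/= in_itv/= => /andP[k1 k2].
    move/eqP : kN; apply; apply/val_inj/eqP => /=.
    rewrite -[eqbLHS](@truncn_def R (g z / e) k)//.
    by rewrite ler_pdivlMr// k1 ltr_pdivrMr.
  by rewrite (ltW t2)/= -natr1 mulrDl mul1r lerD2r.
have s0 z : 0 <= s z by have /andP[+ _] := sE z; apply: le_trans; case/andP: (gM z).
have ms : measurable_fun setT s.
  apply: measurable_sum => k; exact: measurable_funM.
have Es : \sum_(k < K) (k.+1%:R * e) * fine (P (A k)) = \int[P]_z s z.
  rewrite /Rintegral (_ : (\int[P]_z (s z)%:E)%E =
    (\sum_(k < K) (k.+1%:R * e) * fine (P (A k)))%:E)//.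
  transitivity (\int[P]_z (\sum_(k < K) (k.+1%:R * e)%:E * (\1_(A k) z)%:E))%E.
    by apply: eq_integral => z _; rewrite -sumEFin.
  rewrite ge0_integral_sum//.
  - rewrite -sumEFin; apply: eq_bigr => k _; rewrite ge0_integralZl_EFin//.
    + by rewrite integral_indic// setIT [RHS]EFinM fineK//; exact: fin_num_measure.
    + by apply/measurable_EFinP; exact: measurable_indic.
    + by rewrite mulr_ge0// ltW.
  - move=> k; apply/measurable_EFinP; exact: measurable_funM.
  - by move=> k z _; rewrite mule_ge0// lee_fin ?mulr_ge0// ?(ltW e0)// indicE; case: (_ \in _).
have ig : P.-integrable setT (EFin \o g).
  by apply: (@bounded_integrable _ _ _ P g M) => // z; case/andP: (gM z) => ? ?; rewrite ger0_norm.
have ic : P.-integrable setT (EFin \o (fun _ : T => e)).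
  by apply: (@bounded_integrable _ _ _ P _ `|e|).
have Ise : \int[P]_z s z <= \int[P]_z g z + e.
  rewrite -[X in _ + X](Rintegral_prob_cst P) -RintegralD//.
  apply: le_Rintegral => //.
  - apply: (@bounded_integrable _ _ _ P s (M + e)) => // z.
    rewrite ger0_norm//; have /andP[_ /le_trans] := sE z; apply.
    by rewrite lerD2r; case/andP: (gM z).
  - exact: (integrableD _ ig ic).
  - by move=> z _; case/andP: (sE z).
have Is0 : 0 <= \int[P]_z s z by apply: Rintegral_ge0.
apply: (@le_trans _ _ ((\int[P]_z s z) ^+ n)%:E); last first.
  by rewrite lee_fin lerXn2r// nnegrE// (le_trans Is0).
rewrite -Es -iid_prod_simple//; last by move=> k; rewrite mulr_ge0// ltW.
have [c0|c0] := leP 0 c; last first.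
  apply: (@le_trans _ _ 0%E); first by rewrite mule_le0_ge0// lee_fin ltW.
  apply: integral_ge0 => om _; rewrite lee_fin; apply: prodr_ge0 => i _; exact: s0.
have -> : Pr S = (\int[Pr]_om (\1_S om)%:E)%E by rewrite integral_indic// setIT.
rewrite -ge0_integralZl_EFin//; last first.
  by apply/measurable_EFinP; exact: measurable_indic.
apply: ge0_le_integral => //.
- by move=> om _; rewrite mule_ge0// lee_fin// indicE; case: (_ \in _).
- by apply/measurable_EFinP/measurable_funM => //; exact: measurable_indic.
- apply/measurable_EFinP; apply: measurable_prod => i _.
  exact: (measurableT_comp ms (mZ i)).
- move=> om _; rewrite -EFinM lee_fin indicE.
  have h : \prod_(i < n) g (Z i om) <= \prod_(i < n) s (Z i om).
    apply: ler_prod => i _; case/andP: (gM (Z i om)) => -> _ /=.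
    by case/andP: (sE (Z i om)).
  case: (boolP (om \in S)) => [|_]; last by rewrite mulr0; apply: prodr_ge0 => i _; exact: s0.
  by rewrite inE mulr1 => Som; apply: le_trans h.
Qed.

End IidProduct.

(** * Chernoff bound and union bound *)

Section Chernoff.
Context {R : realType} {dT : measure_display} {T : measurableType dT}.
Context {dO : measure_display} {Omega : measurableType dO}.
Context {P : probability T R} {Pr : probability Omega R} {n : nat}.
Context {Z : 'I_n -> Omega -> T}.
Hypothesis iidZ : iid_sample P Pr Z.

(** Chernoff's method: [iid_markov] is applied to exp (- e h / 2), whose product over the sample is
    large exactly when the empirical mean is small. *)
Lemma mean_le_empirical_mean (e B s : R) (h : T -> R) :
  (0 < n)%N -> 0 < e -> measurable_fun setT h -> (forall z, `|h z| <= B) ->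
  \int[P]_z expR (- (e / 2) * h z) <= 1 - e / 10 * \int[P]_z h z ->
  exists S : set Omega, [/\ measurable S, (Pr S <= (expR (- s))%:E)%E &
    forall om, ~ S om -> \int[P]_z h z <=
      5 * (n%:R^-1 * \sum_(i < n) h (Z i om)) + 10 * (1 + s) / (e * n%:R)].
Proof.
move=> n0 e0 mh hB Hm; set mu := \int[P]_z h z in Hm *.
have nR : 0 < n%:R :> R by rewrite ltr0n.
(* The summand 1 pays for the rounding width 1 / n used in [iid_markov], which costs a factor exp (n
   / n). *)
pose c := expR (1 + s - n%:R * (e / 10 * mu)).
have gM z : 0 <= expR (- (e / 2) * h z) <= expR (e / 2 * B).
  rewrite expR_ge0 ler_expR mulNr -mulrN ler_pM2l ?divr_gt0//.
  by have := hB z; rewrite ler_norml => /andP[]; lra.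
have nV : 0 < n%:R^-1 :> R by rewrite invr_gt0.
have [mS PS] := iid_markov iidZ c (measurable_expRM _ mh) gM nV.
eexists; split; first exact: mS.
- have c0 : 0 < c by exact: expR_gt0.
  rewrite -(@lee_pmul2l _ c%:E)//.
  apply: le_trans PS _; rewrite -EFinM lee_fin.
  have I0 : 0 <= \int[P]_z expR (- (e / 2) * h z).
    by apply: Rintegral_ge0 => z _; exact: expR_ge0.
  have h1 : \int[P]_z expR (- (e / 2) * h z) + n%:R^-1 <= expR (n%:R^-1 - e / 10 * mu).
    by apply: le_trans (expR_ge1Dx _); lra.
  have h2 : 0 <= \int[P]_z expR (- (e / 2) * h z) + n%:R^-1 by rewrite addr_ge0// ltW.
  apply: (le_trans (lerXn2r _ h2 _ h1)); first by rewrite nnegrE expR_ge0.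
  rewrite -expRM_natl /c -expRD ler_expR.
  have : n%:R * n%:R^-1 = 1 :> R by rewrite mulfV// gt_eqF.
  by rewrite mulrBr => ->; lra.
- move=> om /negP; rewrite -ltNge -expR_sum ltr_expR -mulr_sumr.
  set u := \sum_(i < n) h (Z i om) => H.
  (* This factor normalises the coefficient of [mu] to 1; the constant 5 is the ratio of 1/2 to
     1/10. *)
  have k0 : 0 < 10 / (e * n%:R) by rewrite divr_gt0// mulr_gt0.
  rewrite -(ltr_pM2l k0) in H.
  have en : e != 0 by rewrite gt_eqF.
  have nn : n%:R != 0 :> R by rewrite gt_eqF.
  have E1 : 10 / (e * n%:R) * (- (e / 2) * u) = - (5 * (n%:R^-1 * u)).
    by field; rewrite en nn.
  have E2 : 10 / (e * n%:R) * (1 + s - n%:R * (e / 10 * mu)) =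
      10 * (1 + s) / (e * n%:R) - mu.
    by field; rewrite en nn.
  by rewrite E1 E2 in H; lra.
Qed.

Lemma union_bound {I : finType} (S : I -> set Omega) (p : R) :
  (forall i, measurable (S i)) -> (forall i, (Pr (S i) <= p%:E)%E) ->
  exists E : set Omega, [/\ measurable E, ((1 - #|I|%:R * p)%:E <= Pr E)%E &
    forall om, E om -> forall i, ~ S i om].
Proof.
move=> mS PS.
have key (r : seq I) : measurable (\big[setU/set0]_(i <- r) S i) /\
    (Pr (\big[setU/set0]_(i <- r) S i) <= ((size r)%:R * p)%:E)%E.
  elim: r => [|i r [mr Pr_r]]; first by rewrite big_nil measure0 mul0r.
  rewrite big_cons; split; first exact: measurableU.
  apply: (@le_trans _ _ (Pr (S i) + Pr (\big[setU/set0]_(j <- r) S j))%E).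
    by apply: measureU2.
  by rewrite -nat1r mulrDl mul1r EFinD leeD.
have [mU PU] := key (index_enum I).
exists (~` \big[setU/set0]_(i <- index_enum I) S i); split.
- exact: measurableC.
- rewrite probability_setC// EFinB leeB//; apply: le_trans PU _.
  by rewrite lee_fin cardT enumT.
- by move=> om nU i Si; apply: nU; rewrite (bigD1 i)//=; left.
Qed.

End Chernoff.

(** * Euclidean geometry and a finite net of the ball *)

Section Euclidean.
Context {R : realType} {d : nat}.
Implicit Types u v w x : 'rV[R]_d.

Lemma norm_le_sqr (x : R) {r : R} : 0 <= r -> (`|x| <= r) = (x ^+ 2 <= r ^+ 2).
Proof.
by move=> r0; rewrite -[in RHS](real_normK (num_real x)) ler_pXn2r ?nnegrE.
Qed.

Lemma normv_leP u {r : R} : 0 <= r ->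
  (normv u <= r) = (\sum_(j < d) u 0 j ^+ 2 <= r ^+ 2).
Proof.
by move=> r0; rewrite /normv -[in LHS](ger0_norm r0) -sqrtr_sqr ler_sqrt// sqr_ge0.
Qed.

(** Cauchy-Schwarz, by summing (u_j - c r x_j)^2 >= 0 over j; the signs c = 1 and c = -1 give the
    two sides of the absolute value. *)
Lemma dotv_le u x (r : R) : 0 < r -> normv u <= r -> normv x <= 1 ->
  `|dotv u x| <= r.
Proof.
move=> r0; rewrite (normv_leP _ (ltW r0)) (normv_leP _ ler01) expr1n => ur x1.
have H (c : R) : c ^+ 2 = 1 -> c * dotv u x <= r.
  move=> c1; rewrite -(ler_pM2l (mulr_gt0 (ltr0Sn R 1) r0)) /dotv mulr_sumr mulr_sumr.
  apply: (@le_trans _ _ (\sum_(j < d) (u 0 j ^+ 2 + r ^+ 2 * x 0 j ^+ 2))).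
    apply: ler_sum => j _; rewrite -subr_ge0.
    have -> : u 0 j ^+ 2 + r ^+ 2 * x 0 j ^+ 2 - 2 * r * (c * (u 0 j * x 0 j)) =
      (u 0 j - c * r * x 0 j) ^+ 2 + (1 - c ^+ 2) * (r * x 0 j) ^+ 2 by ring.
    by rewrite c1 subrr mul0r addr0 sqr_ge0.
  by rewrite big_split/= -mulr_sumr; nra.
rewrite ler_norml; have := H 1; have := H (- 1).
by rewrite sqrrN expr1n => /(_ erefl) ? /(_ erefl) ?; apply/andP; split; lra.
Qed.

Lemma normv_coord u j : normv u <= 1 -> `|u 0 j| <= 1.
Proof.
rewrite (normv_leP _ ler01) expr1n => u1.
rewrite norm_le_sqr// expr1n; apply: le_trans u1.
by rewrite (bigD1 j)//= lerDl sumr_ge0// => i _; exact: sqr_ge0.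
Qed.

Lemma dotvD u v w : dotv (u + v) w = dotv u w + dotv v w.
Proof. by rewrite -big_split; apply: eq_bigr => j _; rewrite mxE mulrDl. Qed.

Lemma dotvZ (c : R) u w : dotv (c *: u) w = c * dotv u w.
Proof. by rewrite mulr_sumr; apply: eq_bigr => j _; rewrite mxE mulrA. Qed.

Lemma normv_convex u v (l r : R) : 0 <= r -> 0 <= l <= 1 ->
  normv u <= r -> normv v <= r -> normv (l *: u + (1 - l) *: v) <= r.
Proof.
move=> r0 /andP[l0 l1]; rewrite !normv_leP// => ur vr.
apply: (@le_trans _ _ (\sum_(j < d) (l * u 0 j ^+ 2 + (1 - l) * v 0 j ^+ 2))).
  apply: ler_sum => j _; rewrite !mxE -subr_ge0.
  have -> : l * u 0 j ^+ 2 + (1 - l) * v 0 j ^+ 2 -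
    (l * u 0 j + (1 - l) * v 0 j) ^+ 2 = l * (1 - l) * (u 0 j - v 0 j) ^+ 2 by ring.
  by rewrite mulr_ge0 ?sqr_ge0// mulr_ge0// subr_ge0.
rewrite big_split/= -!mulr_sumr.
have : l * \sum_(j < d) u 0 j ^+ 2 <= l * r ^+ 2 by rewrite ler_wpM2l.
have : (1 - l) * \sum_(j < d) v 0 j ^+ 2 <= (1 - l) * r ^+ 2.
  by rewrite ler_wpM2l ?subr_ge0.
lra.
Qed.

(* Coordinates are rounded towards zero, which keeps the grid point in the
   ball. *)
Lemma ball_net (N : nat) (r : R) : (0 < N)%N -> 0 < r ->
  exists p : {ffun 'I_d -> 'I_(N.*2.+1)} -> 'rV[R]_d,
    (forall f, normv (p f) <= r) /\
    forall w, normv w <= r -> exists f, forall j, `|w 0 j - p f 0 j| <= r / N%:R.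
Proof.
move=> N0 r0; have NR : 0 < N%:R :> R by rewrite ltr0n.
(* An index in 0..2N encodes a signed multiple in -N..N of the mesh. *)
pose g (f : {ffun 'I_d -> 'I_(N.*2.+1)}) : 'rV[R]_d :=
  \row_j (r / N%:R * ((f j)%:R - N%:R)).
(* Grid points of the cube outside the ball are sent to 0, so that every index yields an admissible
   point. *)
exists (fun f => if normv (g f) <= r then g f else 0); split.
  move=> f; case: ifPn => // _; rewrite (normv_leP _ (ltW r0)).
  by rewrite big1 ?sqr_ge0// => j _; rewrite mxE expr0n.
move=> w wr.
pose t j := Num.truncn (`|w 0 j| * N%:R / r).
have wj j : `|w 0 j| <= r.
  move: wr; rewrite (normv_leP _ (ltW r0)) (norm_le_sqr _ (ltW r0)); apply: le_trans.
  by rewrite (bigD1 j)//= lerDl sumr_ge0// => i _; exact: sqr_ge0.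
have tE j : r / N%:R * (t j)%:R <= `|w 0 j| < r / N%:R * (t j)%:R + r / N%:R.
  have : 0 <= `|w 0 j| * N%:R / r by rewrite divr_ge0 ?mulr_ge0// ltW.
  move=> /truncn_itv /andP[].
  rewrite ler_pdivlMr// ltr_pdivrMr// -/(t j) -natr1 => a b.
  have -> : r / N%:R * (t j)%:R = (t j)%:R * r / N%:R by ring.
  have -> : (t j)%:R * r / N%:R + r / N%:R = ((t j)%:R + 1) * r / N%:R by ring.
  by rewrite ler_pdivrMr// ltr_pdivlMr// a b.
have tN j : (t j <= N)%N.
  rewrite -(ler_nat R); have /andP[+ _] := tE j.
  move=> /le_trans /(_ (wj j)); rewrite mulrAC ler_pdivrMr//.
  by rewrite ler_pM2l.
have bnd (j : 'I_d) : ((if (0 <= w 0 j)%R then N + t j else N - t j) < N.*2.+1)%N.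
  rewrite ltnS -addnn; case: ifP => _; first by rewrite leq_add2l.
  by rewrite (leq_trans (leq_subr _ _))// leq_addr.
pose f := [ffun j => Ordinal (bnd j)].
have gE j : g f 0 j = (if 0 <= w 0 j then 1 else - 1) * (r / N%:R * (t j)%:R).
  rewrite mxE ffunE/=; case: ifP => _; first by rewrite natrD; ring.
  by rewrite natrB//; ring.
have tpos j : 0 <= r / N%:R * (t j)%:R by rewrite mulr_ge0// divr_ge0// ltW.
exists f; rewrite ifT.
  move=> j; rewrite gE; have /andP[] := tE j.
  set q := _ * (t j)%:R; set k := r / _ => q1 q2.
  rewrite ler_norml; case: ifPn q1 q2 => [w0|].
    by rewrite ger0_norm// => *; apply/andP; split; lra.
  by rewrite -ltNge => w0; rewrite ltr0_norm// => *; apply/andP; split; lra.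
move: (wr); rewrite !(normv_leP _ (ltW r0)); apply: le_trans; apply: ler_sum => j _.
rewrite gE; have /andP[q1 _] := tE j; have := tpos j; move: q1.
set q := _ * (t j)%:R => q1 q0.
have -> : ((if 0 <= w 0 j then 1 else -1) * q) ^+ 2 = q ^+ 2.
  by case: ifP => _; ring.
by rewrite -[leRHS](real_normK (num_real _)) -(norm_le_sqr _ (normr_ge0 _)) ger0_norm.
Qed.

End Euclidean.

(** * Lipschitz bound from the derivative *)

Section Lipschitz.
Context {R : realType}.

Lemma derivable_lipschitz (f : R -> R) (G : R) :
  (forall z, derivable f z 1) -> (forall z, `|derive1 f z| <= G) ->
  forall a b, `|f a - f b| <= G * `|a - b|.
Proof.
move=> df fG.
have H a b : a < b -> `|f b - f a| <= G * `|b - a|.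
  move=> ab; have [||c _ ->] := @MVT R f (derive1 f) a b ab.
  - by move=> x _; rewrite derive1E; apply: derivableP.
  - by apply: derivable_within_continuous => x _; exact: df.
  - by rewrite normrM ler_wpM2r.
move=> a b; have [ab|ba|->] := ltgtP a b.
- by rewrite distrC (distrC a); exact: H.
- exact: H.
- by rewrite !subrr normr0 mulr0.
Qed.

End Lipschitz.

(** * Excess risk: exponential moment, degenerate case, empirical minimiser *)

Section ExcessRisk.
Context {R : realType} {d : nat} {dT : measure_display} {T : measurableType dT}.
Context {P : probability T R} {feat : T -> 'rV[R]_d} {lab : T -> R}.
Context {Rad alpha G : R} {ell : R -> R} {wstar : 'rV[R]_d}.
Hypothesis mfeat : forall j, measurable_fun setT (fun z => feat z 0 j).
Hypothesis mlab : measurable_fun setT lab.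
Hypothesis feat1 : forall z, normv (feat z) <= 1.
Hypothesis lab1 : forall z, -1 <= lab z <= 1.
Hypothesis Rad0 : 0 < Rad.
Hypothesis alpha0 : 0 < alpha.
Hypothesis G0 : 0 < G.
Hypothesis expconc : concave_on `[- Rad, Rad] (fun z => expR (- (alpha * ell z))).
Hypothesis dell : forall z, derivable ell z 1.
Hypothesis ellG : forall z, `|derive1 ell z| <= G.
Hypothesis wstarR : normv wstar <= Rad.
Hypothesis wstar_opt : forall w, normv w <= Rad ->
  pop_risk P feat lab ell wstar <= pop_risk P feat lab ell w.

Definition loss w z := ell (lab z * dotv w (feat z)).
Definition excess w z := loss w z - loss wstar z.

Lemma margin_le w z : normv w <= Rad -> `|lab z * dotv w (feat z)| <= Rad.
Proof.
move=> wR; rewrite normrM -[leRHS]mul1r ler_pM//; first by rewrite ler_norml.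
exact: dotv_le.
Qed.

Lemma loss_lip w v z :
  `|loss w z - loss v z| <= G * `|dotv w (feat z) - dotv v (feat z)|.
Proof.
apply: (le_trans (derivable_lipschitz _ _ dell ellG _ _)).
rewrite ler_pM2l// -mulrBr normrM -[leRHS]mul1r ler_wpM2r// ler_norml.
exact: lab1.
Qed.

Lemma loss_lip_coord w v z :
  `|loss w z - loss v z| <= G * \sum_(j < d) `|w 0 j - v 0 j| * `|feat z 0 j|.
Proof.
apply: (le_trans (loss_lip _ _ _)); rewrite ler_pM2l// /dotv -sumrB.
apply: (le_trans (ler_norm_sum _ _ _)); apply: ler_sum => j _.
by rewrite -mulrBl normrM.
Qed.

Lemma measurable_loss w : measurable_fun setT (loss w).
Proof.
have mell : measurable_fun setT ell.
  apply: continuous_measurable_fun => z.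
  exact/differentiable_continuous/derivable1_diffP.
apply: (measurableT_comp mell); apply: measurable_funM => //.
by apply: measurable_sum => j; exact: measurable_funM.
Qed.

Lemma measurable_excess w : measurable_fun setT (excess w).
Proof. by apply: measurable_funB; exact: measurable_loss. Qed.

Lemma excess_le w z : normv w <= Rad -> `|excess w z| <= 2 * G * Rad.
Proof.
move=> wR; apply: le_trans (loss_lip _ _ _) _.
rewrite (mulrC 2) -mulrA ler_pM2l// (le_trans (ler_normB _ _))//.
by rewrite mulr_natl mulr2n lerD// dotv_le.
Qed.

Lemma integrable_excess w : normv w <= Rad -> P.-integrable setT (EFin \o excess w).
Proof.
move=> wR; apply: (bounded_integrable _ (measurable_excess w)) => z.
exact: excess_le.
Qed.

Lemma pop_risk_excess w : normv w <= Rad ->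
  pop_risk P feat lab ell w - pop_risk P feat lab ell wstar = \int[P]_z excess w z.
Proof.
have il v : normv v <= Rad -> P.-integrable setT (EFin \o loss v).
  move=> vR; apply: (bounded_integrable P (measurable_loss v) (B := `|ell 0| + G * Rad)) => z.
  rewrite -[loss v z](subrK (ell 0)) addrC (le_trans (ler_normD _ _))// lerD2l.
  apply: (le_trans (derivable_lipschitz _ _ dell ellG _ _)).
  by rewrite subr0 ler_pM2l// margin_le.
by move=> wR; rewrite -RintegralB//; exact: il.
Qed.

(** The margin is affine in the weight vector, so the segment from [wstar] to [w] is mapped into
    [- Rad, Rad], where exp (- alpha ell) is concave. Multiplying by exp (alpha * loss wstar) turns
    concavity into the last premise of [exp_moment_le1]; optimality of [wstar] gives the nonnegative
    means. *)
Lemma excess_exp_moment w : normv w <= Rad ->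
  \int[P]_z expR (- alpha * excess w z) <= 1.
Proof.
move=> wR; pose wl l := l *: w + (1 - l) *: wstar.
have wlR l : 0 <= l <= 1 -> normv (wl l) <= Rad.
  by move=> l01; apply: normv_convex => //; exact: ltW.
have dot_wl l z : dotv (wl l) (feat z) =
    l * dotv w (feat z) + (1 - l) * dotv wstar (feat z).
  by rewrite dotvD !dotvZ.
apply: (exp_moment_le1 P _ (2 * G * Rad) _ (fun l => excess (wl l))) => //.
- by rewrite !mulr_gt0.
- exact: measurable_excess.
- by move=> z; exact: excess_le.
move=> l l01; split.
- exact: measurable_excess.
- move=> z; apply: le_trans (loss_lip _ _ _) _; rewrite dot_wl.
  have -> : l * dotv w (feat z) + (1 - l) * dotv wstar (feat z) - dotv wstar (feat z)
    = l * (dotv w (feat z) - dotv wstar (feat z)) by ring.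
  have /andP[l0 _] := l01.
  rewrite normrM (ger0_norm l0) mulrCA ler_wpM2l// (mulrC 2) -mulrA ler_pM2l//.
  by rewrite (le_trans (ler_normB _ _))// mulr_natl mulr2n lerD// dotv_le.
- by rewrite -pop_risk_excess ?wlR// subr_ge0 wstar_opt ?wlR.
- move=> z; have := expconc (lab z * dotv w (feat z)) (lab z * dotv wstar (feat z)) l.
  have -> : l * (lab z * dotv w (feat z)) + (1 - l) * (lab z * dotv wstar (feat z)) =
    lab z * dotv (wl l) (feat z) by rewrite dot_wl; ring.
  rewrite /= !in_itv/= -!ler_norml => /(_ (margin_le _ _ wR) (margin_le _ _ wstarR) l01).
  rewrite -!/(loss _ _) => H.
  have E v : expR (- alpha * excess v z) =
      expR (- (alpha * loss v z)) * expR (alpha * loss wstar z).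
    by rewrite -expRD; congr expR; rewrite /excess; ring.
  have E1 : 1 = expR (- (alpha * loss wstar z)) * expR (alpha * loss wstar z).
    by rewrite mulrC expRxMexpNx_1.
  apply: (@le_trans _ _ ((l * expR (- (alpha * loss w z)) +
      (1 - l) * expR (- (alpha * loss wstar z))) * expR (alpha * loss wstar z))).
    by rewrite E mulrDl -!mulrA -E1; lra.
  by rewrite E ler_wpM2r ?expR_ge0.
Qed.

Lemma emp_risk_excess n (Z : 'I_n -> T) w :
  emp_risk (fun i => feat (Z i)) (fun i => lab (Z i)) ell w -
  emp_risk (fun i => feat (Z i)) (fun i => lab (Z i)) ell wstar =
  n%:R^-1 * \sum_(i < n) excess w (Z i).
Proof. by rewrite -mulrBr -sumrB. Qed.

Lemma excess_close (w v : 'rV[R]_d) (r : R) (z : T) :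
  (forall j, `|w 0 j - v 0 j| <= r) ->
  `|excess w z - excess v z| <= G * (d%:R * r).
Proof.
move=> wv; have -> : excess w z - excess v z = loss w z - loss v z.
  by rewrite /excess; ring.
apply: (le_trans (loss_lip_coord _ _ _)); rewrite ler_pM2l//.
apply: (@le_trans _ _ (\sum_(j < d) r)); last first.
  by rewrite sumr_const card_ord mulr_natl.
apply: ler_sum => j _; rewrite -[leRHS]mulr1 ler_pM//.
exact: normv_coord.
Qed.


Lemma excess_risk_le w : normv w <= Rad ->
  pop_risk P feat lab ell w - pop_risk P feat lab ell wstar <= 2 * G * Rad.
Proof.
move=> wR; rewrite pop_risk_excess// -(Rintegral_prob_cst P (2 * G * Rad)).
apply: le_Rintegral => //; first exact: integrable_excess.
  exact: (bounded_integrable P (f := cst (2 * G * Rad)) (B := `|2 * G * Rad|)).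
by move=> z _; rewrite (le_trans (ler_norm _))// excess_le.
Qed.

Lemma integrable_feat_sqr j :
  P.-integrable setT (EFin \o (fun z => feat z 0 j * feat z 0 j)).
Proof.
apply: (bounded_integrable P (B := 1)); first exact: measurable_funM.
by move=> z; rewrite normrM -[leRHS]mulr1 ler_pM// normv_coord.
Qed.

(** The Lipschitz bound together with |x_j| <= k + x_j^2 / k makes the excess risk at most C k for
    every k > 0, which replaces an almost-everywhere argument. *)
Lemma excess_risk_degenerate w : (forall j, \int[P]_z (feat z 0 j * feat z 0 j) <= 0) ->
  normv w <= Rad ->
  pop_risk P feat lab ell w - pop_risk P feat lab ell wstar <= 0.
Proof.
move=> m0 wR; rewrite pop_risk_excess//; apply/ler_addgt0Pr => eps eps0; rewrite add0r.
pose C : R := G * \sum_(j < d) `|w 0 j - wstar 0 j|.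
have C0 : 0 <= C by rewrite mulr_ge0 ?(ltW G0)// sumr_ge0.
(* The added 1 keeps the denominator positive when C = 0. *)
pose k := eps / (C + 1); have k0 : 0 < k by rewrite divr_gt0// ltr_wpDl.
have iS (r : seq 'I_d) :
    P.-integrable setT (EFin \o (fun z => \sum_(j <- r) feat z 0 j * feat z 0 j)) /\
    \int[P]_z (\sum_(j <- r) feat z 0 j * feat z 0 j) <= 0.
  elim: r => [|j r [ir r0]].
    under eq_fun do rewrite big_nil; split.
      by apply: (@bounded_integrable _ _ _ P (cst 0) 0) => // z; rewrite /= normr0.
    by rewrite Rintegral_prob_cst.
  under eq_fun do rewrite big_cons; split.
    exact: (integrableD _ (integrable_feat_sqr j) ir).
  by rewrite (RintegralD _ (integrable_feat_sqr j) ir)// -[leRHS]addr0 lerD.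
have [iq q0] := iS (index_enum 'I_d).
apply: (@le_trans _ _ (\int[P]_z (C * k + C / k * \sum_(j < d) feat z 0 j * feat z 0 j))).
  apply: le_Rintegral => //; first exact: integrable_excess.
    exact: integrable_aff.
  move=> z _; apply: (le_trans (ler_norm _)).
  apply: (le_trans (loss_lip_coord _ _ _)).
  set Q := \sum_(j < d) _ * feat z 0 j.
  have -> : C * k + C / k * Q =
    G * ((\sum_(j < d) `|w 0 j - wstar 0 j|) * (k + k^-1 * Q)).
    by rewrite /C; ring.
  rewrite ler_pM2l// mulr_suml; apply: ler_sum => j _.
  rewrite ler_wpM2l//.
  have h1 : feat z 0 j ^+ 2 <= Q.
    by rewrite /Q (bigD1 j)//= expr2 lerDl sumr_ge0// => i _; rewrite -expr2 sqr_ge0.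
  apply: (@le_trans _ _ (k + k^-1 * feat z 0 j ^+ 2)); last first.
    by rewrite lerD2l ler_pM2l ?invr_gt0.
  rewrite -(ler_pM2l k0) mulrDr mulVKf ?gt_eqF// -(real_normK (num_real (feat z 0 j))).
  have := sqr_ge0 (`|feat z 0 j| - k); have := normr_ge0 (feat z 0 j).
  by nra.
rewrite Rintegral_aff//.
apply: (@le_trans _ _ (C * k)).
  by rewrite gerDl mulr_ge0_le0// divr_ge0// ltW.
by rewrite /k mulrA ler_pdivrMr ?ltr_wpDl// mulrC ler_pM2l// lerDl.
Qed.

(** Testing the Loewner inequality on the j-th basis vector gives theta E[x_j^2] <= E[ell'^2 x_j^2]
    <= G^2 E[x_j^2], so theta > G^2 forces E[x_j^2] <= 0. *)
Lemma theta_le_or_degenerate (theta : R) :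
  loewner_ge (grad_moment P feat lab ell wstar) (theta *: second_moment P feat) ->
  theta <= G ^+ 2 \/ forall j, \int[P]_z (feat z 0 j * feat z 0 j) <= 0.
Proof.
move=> L; have [tG|Gt] := leP theta (G ^+ 2); [by left|right => j].
have := L (delta_mx j 0); rewrite trmx_delta -rowE -colE !mxE subr_ge0 => Lj.
have Gj : \int[P]_z ((derive1 ell (lab z * dotv wstar (feat z))) ^+ 2 *
    feat z 0 j * feat z 0 j)
    <= G ^+ 2 * \int[P]_z (feat z 0 j * feat z 0 j).
  rewrite -RintegralZl//; last exact: integrable_feat_sqr.
  have iG := integrable_aff P 0 (G ^+ 2) (integrable_feat_sqr j).
  have fin : (\int[P]_z (G ^+ 2 * (feat z 0 j * feat z 0 j))%:E)%E \is a fin_num.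
    by apply: integrable_fin_num => //; move: iG; under eq_fun do rewrite add0r.
  have le : (\int[P]_z ((derive1 ell (lab z * dotv wstar (feat z))) ^+ 2 *
    feat z 0 j * feat z 0 j)%:E
    <= \int[P]_z (G ^+ 2 * (feat z 0 j * feat z 0 j))%:E)%E.
    apply: ge0_le_integralT => z; rewrite lee_fin -mulrA -expr2.
      by rewrite mulr_ge0 ?sqr_ge0.
    by rewrite ler_wpM2r ?sqr_ge0// -norm_le_sqr ?(ltW G0).
  apply: fine_le => //; rewrite ge0_fin_numE.
    apply: le_lt_trans le _; rewrite -ge0_fin_numE// integral_ge0// => z _.
    by rewrite lee_fin mulr_ge0 ?sqr_ge0// -expr2 sqr_ge0.
  by apply: integral_ge0 => z _; rewrite lee_fin -mulrA -expr2 mulr_ge0 ?sqr_ge0.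
have := le_trans Lj Gj; rewrite -subr_ge0 -mulrBl.
by rewrite nmulr_rge0 // subr_lt0.
Qed.


(** Since [what] depends on the sample, concentration is applied to the fixed grid points and
    transferred to it. The move to a grid point costs at most G Rad / n once in the population mean
    and 5 times in the empirical mean, hence the 6. *)
Lemma erm_excess_risk {dO : measure_display} {Omega : measurableType dO}
    {Pr : probability Omega R} {n : nat} (Z : 'I_n -> Omega -> T)
    (what : Omega -> 'rV[R]_d) (e t : R) :
  iid_sample P Pr Z -> (1 < n)%N -> (d <= n)%N ->
  0 < e <= alpha -> e * (2 * G * Rad) <= 1 -> 0 < t ->
  (forall om, normv (what om) <= Rad /\
     forall w, normv w <= Rad ->
       emp_risk (fun i => feat (Z i om)) (fun i => lab (Z i om)) ell (what om)
       <= emp_risk (fun i => feat (Z i om)) (fun i => lab (Z i om)) ell w) ->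
  exists E : set Omega, [/\ measurable E, ((1 - expR (- t))%:E <= Pr E)%E &
    forall om, E om ->
      pop_risk P feat lab ell (what om) - pop_risk P feat lab ell wstar
      <= 6 * (G * Rad) / n%:R + 40 * (t + 2 + d%:R * ln n%:R) / (e * n%:R)].
Proof.
move=> iidZ n1 dn e0alpha eB t0 erm.
have n0 : (0 < n)%N by exact: ltn_trans n1.
have nn0 : (0 < n ^ 2)%N by rewrite expn_gt0 n0.
have nR : 0 < n%:R :> R by rewrite ltr0n.
have /andP[e0 _] := e0alpha.
have ln0 : 0 <= ln n%:R :> R by rewrite ln_ge0// ler1n.
have [p [pR pnet]] := @ball_net R d (n ^ 2) Rad nn0 Rad0.
(* The grid has (2 n^2 + 1)^d points, at most n^(4 d) because n >= 2; the second summand absorbs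
   this cardinality. *)
pose s := t + d%:R * (4 * ln n%:R).
have /choice[S HS] : forall f, exists S : set Omega, [/\ measurable S,
    (Pr S <= (expR (- s))%:E)%E & forall om, ~ S om ->
    \int[P]_z excess (p f) z <=
      5 * (n%:R^-1 * \sum_(i < n) excess (p f) (Z i om)) + 10 * (1 + s) / (e * n%:R)].
  move=> f; apply: (mean_le_empirical_mean iidZ _ (2 * G * Rad)) => //.
  - exact: measurable_excess.
  - by move=> z; apply: excess_le.
  - apply: (exp_moment_contract P alpha e (2 * G * Rad)) => //.
    + exact: measurable_excess.
    + by move=> z; apply: excess_le.
    + exact: excess_exp_moment.
have mS f : measurable (S f) by case: (HS f).
have PS f : (Pr (S f) <= (expR (- s))%:E)%E by case: (HS f).
have [E [mE PE HE]] := union_bound S _ mS PS.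
exists E; split=> //.
  apply: le_trans PE; rewrite lee_fin lerD2l lerN2 card_ffun !card_ord.
  rewrite /s opprD expRD mulrCA -[leRHS]mulr1 ler_pM2l ?expR_gt0//.
  rewrite expRN -ler_pdivlMr ?invr_gt0 ?expR_gt0// div1r invrK.
  rewrite mulrC expRM_natr (_ : 4 * ln n%:R = ln n%:R * 4%:R); last by rewrite mulrC.
  rewrite expRM_natr lnK ?posrE// natrX; apply: lerXn2r; rewrite ?nnegrE ?exprn_ge0//.
  rewrite -natrX ler_nat -muln2.
  have n4 : (4 <= n ^ 2)%N by rewrite (@leq_exp2r 2 n 2).
  rewrite (expnM n 2 2) expnS expn1.
  apply: (@leq_trans (n ^ 2 * 4)%N); last by rewrite leq_mul2l n4 orbT.
  by rewrite (_ : 4 = 2 + 2)%N// mulnDr -addn1 leq_add2l (leq_trans _ (leq_pmulr _ _)).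
move=> om Eom; have [wR wmin] := erm om.
have [f wf] := pnet _ wR; have [_ _ /(_ om (HE om Eom f)) Hf] := HS f.
set rr := Rad / (n ^ 2)%:R in wf.
have close z : `|excess (what om) z - excess (p f) z| <= G * (d%:R * rr).
  exact: excess_close.
(* Here d <= n turns the mesh Rad / n^2, summed over d coordinates, into Rad / n. *)
have dr : d%:R * rr <= Rad / n%:R.
  have -> : d%:R * rr = (d%:R / n%:R) * (Rad / n%:R).
    by rewrite /rr natrX; field; rewrite gt_eqF.
  rewrite ler_piMl ?(divr_ge0, ltW Rad0)// ler_pdivrMr// mul1r ler_nat//.
have Gdr : G * (d%:R * rr) <= G * Rad / n%:R by rewrite -mulrA ler_pM2l.
have emp0 : n%:R^-1 * \sum_(i < n) excess (what om) (Z i om) <= 0.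
  by rewrite -(emp_risk_excess _ (fun i => Z i om)) subr_le0 wmin.
have empf : n%:R^-1 * \sum_(i < n) excess (p f) (Z i om) <= G * Rad / n%:R.
  apply: (@le_trans _ _ (n%:R^-1 * \sum_(i < n) (excess (what om) (Z i om) + G * Rad / n%:R))).
    rewrite ler_pM2l ?invr_gt0//; apply: ler_sum => i _.
    by have := close (Z i om); rewrite ler_norml => /andP[]; lra.
  rewrite big_split/= sumr_const card_ord mulrDr -(mulr_natl (G * Rad / n%:R) n) mulKf ?gt_eqF//.
  by lra.
have popf : \int[P]_z excess (what om) z <= G * Rad / n%:R + \int[P]_z excess (p f) z.
  have ip := integrable_aff P (G * Rad / n%:R) 1 (integrable_excess (p f) (pR f)).
  rewrite -[X in _ + X]mul1r -Rintegral_aff//; last exact: integrable_excess.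
  apply: le_Rintegral => //; first exact: integrable_excess.
  by move=> z _; have := close z; rewrite ler_norml mul1r => /andP[]; lra.
have hs : 10 * (1 + s) / (e * n%:R) <= 40 * (t + 2 + d%:R * ln n%:R) / (e * n%:R).
  by rewrite ler_pM2r ?invr_gt0 ?mulr_gt0// /s; lra.
rewrite pop_risk_excess//; rewrite -mulrA; lra.
Qed.

End ExcessRisk.

(** * Case analysis and choice of constants *)

Theorem theorem1 (R : realType) (d n : nat)
  (dT : measure_display) (T : measurableType dT) (P : probability T R)
  (feat : T -> 'rV[R]_d) (lab : T -> R)
  (dO : measure_display) (Omega : measurableType dO) (Pr : probability Omega R)
  (Z : 'I_n -> Omega -> T)
  (Rad alpha G theta : R) (ell : R -> R)
  (wstar : 'rV[R]_d) (what : Omega -> 'rV[R]_d) (t : R) :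
  (0 < n)%N ->
  (forall j, measurable_fun setT (fun z => feat z 0 j)) ->
  measurable_fun setT lab ->
  (forall z, normv (feat z) <= 1) ->
  (forall z, -1 <= lab z <= 1) ->
  iid_sample P Pr Z ->
  0 < Rad -> 0 < alpha -> 0 < G -> 0 < theta ->
  (forall z, 0 <= ell z) ->
  convex_on setT ell ->
  concave_on `[- Rad, Rad] (fun z => expR (- (alpha * ell z))) ->
  (forall z, derivable ell z 1) ->
  (forall z, `|derive1 ell z| <= G) ->
  normv wstar <= Rad ->
  (forall w, normv w <= Rad ->
     pop_risk P feat lab ell wstar <= pop_risk P feat lab ell w) ->
  loewner_ge (grad_moment P feat lab ell wstar)
             (theta *: second_moment P feat) ->
  (forall om, normv (what om) <= Rad /\
     forall w, normv w <= Rad ->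
       emp_risk (fun i => feat (Z i om)) (fun i => lab (Z i om)) ell (what om)
       <= emp_risk (fun i => feat (Z i om)) (fun i => lab (Z i om)) ell w) ->
  0 < t ->
  let gamma := Num.max 1 (Num.max (G ^+ 2 / theta) (G / (alpha * theta * Rad))) in
  let rho0 := Num.max (32 * gamma) (Num.sqrt (gamma * (28 + 3 / (G * Rad)))) in
  exists E : set Omega, measurable E /\
    ((1 - 2 * (up_log 2 n)%:R * expR (- t))%:E <= Pr E)%E /\
    forall om, E om ->
      pop_risk P feat lab ell (what om) - pop_risk P feat lab ell wstar
      <= (G * Rad * (32 * rho0 + 28) + 3) * ((t + 2 + d%:R * ln n%:R) / n%:R).
Proof.
move=> n0 mfeat mlab feat1 lab1 iidZ Rad0 alpha0 G0 theta0 _ _ expconc dell ellG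
  wstarR wstar_opt L erm t0 gamma rho0.
(* For a deterministic bound the whole space serves as the event. *)
have trivial_event (b : R) :
    (forall w, normv w <= Rad ->
       pop_risk P feat lab ell w - pop_risk P feat lab ell wstar <= b) ->
    exists E : set Omega, measurable E /\
      ((1 - 2 * (up_log 2 n)%:R * expR (- t))%:E <= Pr E)%E /\
      forall om, E om ->
        pop_risk P feat lab ell (what om) - pop_risk P feat lab ell wstar <= b.
  move=> H; exists setT; split=> //; split; last first.
    by move=> om _; apply: H; case: (erm om).
  by rewrite probability_setT lee_fin gerBl !mulr_ge0 ?expR_ge0.
have GR0 : 0 < G * Rad by rewrite mulr_gt0.
have nR : 0 < n%:R :> R by rewrite ltr0n.
have ln0 : 0 <= ln n%:R :> R by rewrite ln_ge0// ler1n.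
have gamma1 : 1 <= gamma by rewrite /gamma le_max lexx.
have rho_gamma : 32 * gamma <= rho0 by rewrite /rho0 le_max lexx.
have gamma_ge : G / (alpha * theta * Rad) <= gamma by rewrite /gamma !le_max lexx !orbT.
clearbody rho0; clearbody gamma.
set Q := t + 2 + d%:R * ln n%:R.
have Q2 : 2 <= Q by have := mulr_ge0 (ler0n R d) ln0; rewrite /Q; lra.
set K := G * Rad * (32 * rho0 + 28) + 3.
have K_lb : G * Rad * (80 * gamma + 28) <= K.
  by rewrite /K ler_wpDr// ler_pM2l//; lra.
have K28 : G * Rad * 28 <= K.
  by apply: le_trans _ K_lb; rewrite ler_pM2l//; lra.
have K0 : 0 <= K.
  by apply: le_trans _ K28; apply: mulr_ge0; [exact: ltW | lra].
clearbody K.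
have [thetaG|m0] := theta_le_or_degenerate mfeat feat1 G0 ellG _ L; last first.
  apply: trivial_event => w wR.
  apply: (le_trans (excess_risk_degenerate mfeat mlab feat1 lab1 Rad0 G0 dell
    ellG wstarR w m0 wR)).
  by rewrite mulr_ge0// divr_ge0 ?(ltW nR)//; lra.
(* As K >= 28 G Rad, it suffices that Q / n >= 1/14. For n = 1 this follows from Q >= 2, and for 1 <
   n < d from d ln n >= n / 2. *)
have trivial_bound : n = 1%N \/ (n < d)%N -> 2 * G * Rad <= K * (Q / n%:R).
  move=> small; have h : 1 / 14 <= Q / n%:R.
    rewrite ler_pdivlMr//; case: small => [->|nd]; first by lra.
    have [n_1|n1] := leqP n 1; first
      by rewrite (le_trans _ Q2)// (_ : n = 1%N) ?mulr1; [lra|apply/anti_leq/andP].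
    (* exp (1/2) <= 2, from exp (- 1/2) >= 1 - 1/2. *)
    have l2 : 1 / 2 <= ln n%:R :> R.
      rewrite -(@expRK R (1 / 2)) ler_ln ?posrE ?expR_gt0//.
      apply: (@le_trans _ _ 2); last by rewrite ler_nat.
      have := expR_ge1Dx (- (1 / 2) : R); have := @expRxMexpNx_1 R (1 / 2).
      have := expR_gt0 (1 / 2 : R); nra.
    have : n%:R * (1 / 2) <= d%:R * ln n%:R :> R by rewrite ler_pM// ?ler_nat ?(ltnW nd).
    by rewrite /Q; lra.
  apply: (@le_trans _ _ (G * Rad * 28 * (1 / 14))); first by lra.
  apply: ler_pM; [|lra|exact: K28|exact: h].
  by apply: mulr_ge0; [exact: ltW | lra].
have [n1|n1] := leqP n 1.
  apply: trivial_event => w wR.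
  apply: (le_trans (excess_risk_le mfeat mlab feat1 lab1 Rad0 G0 dell ellG
    wstarR w wR)).
  by apply: trivial_bound; left; apply/anti_leq/andP.
have [dn|nd] := leqP d n; last first.
  apply: trivial_event => w wR.
  apply: (le_trans (excess_risk_le mfeat mlab feat1 lab1 Rad0 G0 dell ellG
    wstarR w wR)).
  by apply: trivial_bound; right.
(* gamma >= 1 makes e times the excess bound 2 G Rad at most 1; the third entry of gamma, combined
   with theta <= G^2, gives e <= alpha. *)
pose e := (2 * G * Rad * gamma)^-1.
have gamma0 : 0 < gamma by apply: lt_le_trans gamma1.
have e0 : 0 < e by rewrite invr_gt0 !mulr_gt0.
have gamma_alpha : 1 <= G * Rad * gamma * alpha.
  move: gamma_ge; rewrite ler_pdivrMr ?mulr_gt0// => h.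
  rewrite -(ler_pM2l G0) mulr1; apply: (le_trans h).
  have -> : gamma * (alpha * theta * Rad) = gamma * alpha * Rad * theta by ring.
  have -> : G * (G * Rad * gamma * alpha) = gamma * alpha * Rad * G ^+ 2 by ring.
  by rewrite ler_wpM2l// !mulr_ge0// ltW.
have ealpha : 0 < e <= alpha.
  rewrite e0/= /e -div1r ler_pdivrMr ?mulr_gt0//; lra.
have eB : e * (2 * G * Rad) <= 1.
  have GR2 : 0 < 2 * G * Rad by rewrite !mulr_gt0.
  by rewrite /e mulrC ler_pdivrMr ?mulr_gt0// mul1r ler_peMr// ltW.
have [E [mE PE HE]] := erm_excess_risk mfeat mlab feat1 lab1 Rad0 alpha0 G0 expconc
  dell ellG wstarR wstar_opt Z what e t iidZ n1 dn ealpha eB t0 erm.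
exists E; split=> //; split.
  (* The event already has failure probability at most exp (- t), and [up_log 2 n] is at least 1 for
     n >= 2. *)
  apply: le_trans PE; rewrite lee_fin lerD2l lerN2 ler_peMl ?expR_ge0//.
  have : (1 <= up_log 2 n)%N by rewrite up_log_gt0.
  by rewrite -(ler_nat R); lra.
move=> om /HE; rewrite -/Q => /le_trans; apply.
have -> : 40 * Q / (e * n%:R) = 80 * (G * Rad * gamma) * (Q / n%:R).
  rewrite /e; field; rewrite !gt_eqF//.
rewrite -mulrA; set q := Q / n%:R.
(* Since Q >= 2, the discretisation cost 6 G Rad / n is at most 3 G Rad q, which the 28 in [K]
   covers. *)
have q2 : 2 * n%:R^-1 <= q by rewrite ler_pM2r ?invr_gt0.
have q0 : 0 < q by rewrite divr_gt0//; lra.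
clearbody q.
have : K * q >= G * Rad * (80 * gamma + 28) * q by rewrite ler_pM2r.
have : G * Rad * (2 * n%:R^-1) <= G * Rad * q by rewrite ler_pM2l.
have : 0 < G * Rad * gamma * q by rewrite !mulr_gt0.
have : 0 < G * Rad * q by rewrite !mulr_gt0.
by lra.
Qed.
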